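(* Let $(M^{2n+1},\phi,\xi,\eta,g)$, $n\ge 2$, be an almost contact metric manifold, $(N^{2n},J^N,h)$ an (almost) Hermitian manifold, and $\varphi:M\to N$ a smooth map. Let $\mathcal{C}(M)$ be the cone over $M$, with its almost complex structure $J$ and metric $\widehat g$, let $\pi:\mathcal C(M)\to M$ be the standard projection, and put $\widehat\varphi=\varphi\circ\pi$. Then: (i) $\varphi$ is $(\phi,J^N)$-holomorphic if and only if $\widehat\varphi$ is holomorphic, i.e. $d\widehat\varphi\circ J=J^N\circ d\widehat\varphi$. (ii) $\varphi:(M,g)\to(N,J^N,h)$ is a PHWC harmonic map if and only if $\widehat\varphi:(\mathcal C(M),\widehat g)\to(N,J^N,h)$ is a PHWC harmonic map; if moreover $h$ is a Kähler metric on $(N,J^N)$, this says that $\varphi$ is a strong pseudo-harmonic morphism if and only if $\widehat\varphi$ is. (iii) $\varphi$ is submersive if and only if $\widehat\varphi$ is submersive. In this case, for a complex submanifold $P$ of $N$, if $\varphi^{-1}(P)$ is a minimal submanifold of $(M,g)$, then $\widehat\varphi^{-1}(P)$ is a minimal submanifold of $(\mathcal C(M),\widehat g)$. (iv) $\varphi:(M,g)\to(N,J^N)$ is a pseudo-harmonic morphism if and only if $\widehat\varphi:(\mathcal C(M),\widehat g)\to(N,J^N)$ is a pseudo-harmonic morphism.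
   Context: An almost contact metric structure $(\phi,\xi,\eta,g)$ on $M^{2n+1}$ satisfies $\phi^2=-I+\eta\otimes\xi$, $\eta(\xi)=1$, $g(\phi X,\phi Y)=g(X,Y)-\eta(X)\eta(Y)$. The cone is $\mathcal C(M)=M\times\mathbb{R}_{>0}$ with coordinate $t$ on the second factor, almost complex structure $J\left(X,f\frac{d}{dt}\right)=\left(\phi X-f\xi,\ \eta(X)\frac{d}{dt}\right)$ and warped product metric $\widehat g=dt\otimes dt+t^2g$. $\varphi$ is $(\phi,J^N)$-holomorphic if $d\varphi\circ\phi=J^N\circ d\varphi$. A map $\psi:(P,k)\to(N,J^N,h)$ from a Riemannian manifold is PHWC (pseudo horizontally weakly conformal) if $[d\psi\circ d\psi^*,J^N]=0$, where $d\psi^*$ is the pointwise adjoint of $d\psi$ with respect to $k$ and $h$. A map from a Riemannian manifold to an (almost) complex manifold is a pseudo-harmonic morphism (PHM) if it pulls back locally defined holomorphic functions to locally defined harmonic functions. A strong PHM is a PHM whose target is Kähler (equivalently, a PHWC harmonic map to a Kähler manifold). A function $f$ is holomorphic if $df\circ J^N=\mathrm{i}\,df$. *)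

(* Defs.v *)
From HB Require Import structures.
From mathcomp Require Import all_boot all_order all_algebra.
From mathcomp Require Import all_classical all_reals.
From mathcomp Require Import interval_inference topology normedtype landau derive.
From mathcomp Require Import complex.
Set Implicit Arguments.
Unset Strict Implicit.
Unset Printing Implicit Defensive.
Import Order.TTheory GRing.Theory Num.Theory.
Import numFieldNormedType.Exports.
Local Open Scope classical_set_scope.
Local Open Scope ring_scope.

(** Vectors are rows, so the matrix [A] of a linear map acts by [v |-> v *m A],
    composites read from left to right, and the derivative of [F] at [x] is
    [v |-> v *m 'J F x]. *)

Section Calculus.
Variable R : realType.

Definition partial m (V : normedModType R) (i : 'I_m) (F : 'rV[R]_m -> V)
  (x : 'rV[R]_m) : V := 'D_(delta_mx 0 i) F x.

(** Meant for open [U]: [F] is differentiable on [U] and its partial derivatives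
    are of class [C^(k-1)]. *)
Fixpoint Ck m (V : normedModType R) (k : nat) (U : set 'rV[R]_m)
    (F : 'rV[R]_m -> V) : Prop :=
  if k is k'.+1 then
    (forall x, U x -> differentiable F x) /\
    (forall i : 'I_m, Ck k' U (partial i F))
  else forall x, U x -> {for x, continuous F}.

Definition smooth m (V : normedModType R) (U : set 'rV[R]_m)
  (F : 'rV[R]_m -> V) : Prop := forall k, Ck k U F.

(** Below, [G x] is the Gram matrix at [x] of a metric on an open subset of
    [R^m], in the standard coordinates. *)

(** Row of the Christoffel symbols [Gamma^k_ij], [k] ranging over ['I_m]. *)
Definition christoffel m (G : 'rV[R]_m -> 'M[R]_m) (x : 'rV[R]_m)
    (i j : 'I_m) : 'rV[R]_m :=
  \row_k (2^-1 * \sum_l invmx (G x) k l *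
    (partial i (fun y => G y j l : R) x + partial j (fun y => G y i l : R) x
     - partial l (fun y => G y i j : R) x)).

Definition christoffel_form m (G : 'rV[R]_m -> 'M[R]_m) (x : 'rV[R]_m)
    (v w : 'rV[R]_m) : 'rV[R]_m :=
  \sum_i \sum_j (v 0 i * w 0 j) *: christoffel G x i j.

(** [(nabla dF)(d_i, d_j)] for [F] from [(R^m, G)] to a vector space. *)
Definition hessian m (V : normedModType R) (G : 'rV[R]_m -> 'M[R]_m)
    (F : 'rV[R]_m -> V) (x : 'rV[R]_m) (i j : 'I_m) : V :=
  partial i (partial j F) x - \sum_k christoffel G x i j 0 k *: partial k F x.

Definition laplacian m (G : 'rV[R]_m -> 'M[R]_m) (u : 'rV[R]_m -> R)
    (x : 'rV[R]_m) : R :=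
  \sum_i \sum_j invmx (G x) i j * hessian G u x i j.

(** Trace of [nabla dF] for [F : (R^m, G) -> (R^k, H)]. *)
Definition tension m k (G : 'rV[R]_m -> 'M[R]_m) (H : 'rV[R]_k -> 'M[R]_k)
    (F : 'rV[R]_m -> 'rV[R]_k) (x : 'rV[R]_m) : 'rV[R]_k :=
  \sum_i \sum_j invmx (G x) i j *:
    (hessian G F x i j
     + christoffel_form H (F x) (partial i F x) (partial j F x)).

(** Mean curvature vector (trace of the second fundamental form) of the
    immersion [X : R^k -> (R^m, G)]. *)
Section MeanCurvature.
Variables (m k : nat) (G : 'rV[R]_m -> 'M[R]_m) (X : 'rV[R]_k -> 'rV[R]_m).

Definition first_form (u : 'rV[R]_k) : 'M[R]_k :=
  'J X u *m G (X u) *m ('J X u)^T.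

Definition normal_part (u : 'rV[R]_k) (v : 'rV[R]_m) : 'rV[R]_m :=
  v - v *m G (X u) *m ('J X u)^T *m invmx (first_form u) *m 'J X u.

Definition second_form (u : 'rV[R]_k) (a b : 'I_k) : 'rV[R]_m :=
  normal_part u (partial a (partial b X) u
    + christoffel_form G (X u) (partial a X u) (partial b X u)).

Definition mean_curvature (u : 'rV[R]_k) : 'rV[R]_m :=
  \sum_a \sum_b invmx (first_form u) a b *: second_form u a b.

End MeanCurvature.

(** Adjoint of [v |-> v *m D] for the scalar products with Gram matrices [K]
    on the source and [H] on the target; see [adjoint_mxP]. *)
Definition adjoint_mx m k (K : 'M[R]_m) (H : 'M[R]_k) (D : 'M[R]_(m, k)) :
  'M[R]_(k, m) := H *m D^T *m invmx K.

Lemma adjoint_mxP m k (K : 'M[R]_m) (H : 'M[R]_k) (D : 'M[R]_(m, k))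
    (v : 'rV[R]_m) (w : 'rV[R]_k) : K \in unitmx ->
  (w *m adjoint_mx K H D) *m K *m v^T = w *m H *m (v *m D)^T.
Proof. by move=> uK; rewrite /adjoint_mx trmx_mul !mulmxA mulmxKV. Qed.

End Calculus.

Section Charts.
Variable R : realType.

(** A homeomorphism between an open subset of [T] and an open subset of [R^m];
    [cmap] and [cinv] are meaningful only there. *)
Record chart (T : topologicalType) (m : nat) := Chart {
  cdom : set T;
  cmap : T -> 'rV[R]_m;
  cinv : 'rV[R]_m -> T;
  cdom_open : open cdom;
  cimg_open : open (cmap @` cdom);
  cmapK : forall p, cdom p -> cinv (cmap p) = p;
  cmap_continuous : forall p, cdom p -> {for p, continuous cmap};
  cinv_continuous : forall p, cdom p -> {for cmap p, continuous cinv} }.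

Definition smooth_change (T : topologicalType) m (c d : chart T m) : Prop :=
  smooth (cmap c @` (cdom c `&` cdom d)) (cmap d \o cinv c).

Record manifold (m : nat) := Manifold {
  points :> topologicalType;
  mf_hausdorff : hausdorff_space points;
  mf_second_countable : @second_countable points;
  chart_id : Type;
  charts : chart_id -> chart points m;
  charts_cover : forall p, exists c, cdom (charts c) p;
  charts_smooth : forall c d, smooth_change (charts c) (charts d) }.

End Charts.

Section Manifolds.
Variable R : realType.
Implicit Types m k : nat.

Definition dom m (M : manifold R m) (c : chart_id M) : set M := cdom (charts c).
Definition crd m (M : manifold R m) (c : chart_id M) : M -> 'rV[R]_m :=
  cmap (charts c).
Definition pnt m (M : manifold R m) (c : chart_id M) : 'rV[R]_m -> M :=
  cinv (charts c).

Definition local_expr m k (M : manifold R m) (N : manifold R k) (f : M -> N)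
  (c : chart_id M) (d : chart_id N) : 'rV[R]_m -> 'rV[R]_k := crd d \o f \o pnt c.

Definition dmx m k (M : manifold R m) (N : manifold R k) (f : M -> N)
  (c : chart_id M) (d : chart_id N) (p : M) : 'M[R]_(m, k) :=
  'J (local_expr f c d) (crd c p).

Definition smooth_map m k (M : manifold R m) (N : manifold R k) (f : M -> N) :=
  continuous f /\
  forall c d, smooth (crd c @` (dom c `&` f @^-1` dom d)) (local_expr f c d).

Definition smooth_fun m (M : manifold R m) (V : set M) (u : M -> R) :=
  forall c, smooth (crd c @` (dom c `&` V)) (u \o pnt c).

Definition submersive m k (M : manifold R m) (N : manifold R k) (f : M -> N) :=
  forall p c d, dom c p -> dom d (f p) -> row_full (dmx f c d p).

(** A tensor field is given by its components in each chart, [t c p] being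
    relevant only if [dom c p]; the components obey the usual transformation
    law, where [chg c d p] is the Jacobian matrix of the change from chart [c]
    to chart [d]. *)

Definition chg m (M : manifold R m) (c d : chart_id M) (p : M) : 'M[R]_m :=
  'J (crd d \o pnt c) (crd c p).

Definition smooth_components m (M : manifold R m) (V : normedModType R)
    (t : chart_id M -> M -> V) :=
  forall c, smooth (crd c @` dom c) (t c \o pnt c).

Definition vector_field m (M : manifold R m) (X : chart_id M -> M -> 'rV[R]_m) :=
  smooth_components X /\
  forall c d p, dom c p -> dom d p -> X c p *m chg c d p = X d p.

(** A 1-form [a] is the column such that [a(v) = v *m a]. *)
Definition one_form m (M : manifold R m) (a : chart_id M -> M -> 'cV[R]_m) :=
  smooth_components a /\
  forall c d p, dom c p -> dom d p -> a c p = chg c d p *m a d p.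

Definition endomorphism_field m (M : manifold R m)
    (F : chart_id M -> M -> 'M[R]_m) :=
  smooth_components F /\
  forall c d p, dom c p -> dom d p ->
    F c p *m chg c d p = chg c d p *m F d p.

Definition riemannian_metric m (M : manifold R m)
    (g : chart_id M -> M -> 'M[R]_m) :=
  [/\ smooth_components g,
      forall c d p, dom c p -> dom d p ->
        g c p = chg c d p *m g d p *m (chg c d p)^T,
      forall c p, dom c p -> (g c p)^T = g c p
    & forall c p (v : 'rV[R]_m), dom c p -> v != 0 ->
        0 < (v *m g c p *m v^T) 0 0].

Record almost_contact_metric m (M : manifold R m)
    (phi : chart_id M -> M -> 'M[R]_m) (xi : chart_id M -> M -> 'rV[R]_m)
    (eta : chart_id M -> M -> 'cV[R]_m) (g : chart_id M -> M -> 'M[R]_m) : Prop := {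
  acm_phi : endomorphism_field phi;
  acm_xi : vector_field xi;
  acm_eta : one_form eta;
  acm_g : riemannian_metric g;
  acm_phi2 : forall c p, dom c p ->
    phi c p *m phi c p = - 1%:M + eta c p *m xi c p;
  acm_eta_xi : forall c p, dom c p -> xi c p *m eta c p = 1%:M;
  acm_compat : forall c p, dom c p ->
    phi c p *m g c p *m (phi c p)^T = g c p - eta c p *m (eta c p)^T }.

Record almost_hermitian m (M : manifold R m)
    (J h : chart_id M -> M -> 'M[R]_m) : Prop := {
  ah_J : endomorphism_field J;
  ah_h : riemannian_metric h;
  ah_J2 : forall c p, dom c p -> J c p *m J c p = - 1%:M;
  ah_compat : forall c p, dom c p -> J c p *m h c p *m (J c p)^T = h c p }.

(** Column of the complex differential of [f] in the chart [c]. *)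
Definition cdiff m (M : manifold R m) (f : M -> R[i]) (c : chart_id M) (p : M) :
    'cV[R[i]]_m :=
  \col_j Complex (partial j (@complex.Re R \o f \o pnt c : _ -> R) (crd c p))
                 (partial j (@complex.Im R \o f \o pnt c : _ -> R) (crd c p)).

(** [df o J = i df] on the open set [V]. *)
Definition holomorphic m (M : manifold R m) (J : chart_id M -> M -> 'M[R]_m)
    (V : set M) (f : M -> R[i]) :=
  [/\ smooth_fun V (@complex.Re R \o f), smooth_fun V (@complex.Im R \o f)
    & forall c p, V p -> dom c p ->
        map_mx (real_complex R) (J c p) *m cdiff f c p
        = Complex 0 1 *: cdiff f c p].

(** [J] comes from a complex manifold structure: around every point there is a
    chart [z] of the smooth structure whose coordinates
    [z_k + i z_(n + k)], [k < n], are holomorphic. *)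
Definition integrable_acs n (N : manifold R (n + n))
    (J : chart_id N -> N -> 'M[R]_(n + n)) :=
  forall q : N, exists z : chart R N (n + n),
    [/\ cdom z q,
        forall c : chart_id N,
          smooth_change z (charts c) /\ smooth_change (charts c) z
      & forall k : 'I_n, holomorphic J (cdom z)
          (fun p => Complex (cmap z p 0 (lshift n k))
                            (cmap z p 0 (rshift n k)))].

(** The fundamental 2-form [omega(X, Y) = h(J X, Y)] is closed. *)
Definition closed_fundamental_form m (N : manifold R m)
    (J h : chart_id N -> N -> 'M[R]_m) :=
  forall (d : chart_id N) (q : N) (i j k : 'I_m), dom d q ->
    let omega (a b : 'I_m) (y : 'rV[R]_m) : R :=
      (J d (pnt d y) *m h d (pnt d y)) a b in
    partial i (omega j k) (crd d q) + partial j (omega k i) (crd d q)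
    + partial k (omega i j) (crd d q) = 0.

Definition kahler n (N : manifold R (n + n))
    (J h : chart_id N -> N -> 'M[R]_(n + n)) :=
  [/\ almost_hermitian J h, integrable_acs J & closed_fundamental_form J h].

(** [df o A = B o df]. *)
Definition intertwines m k (M : manifold R m) (N : manifold R k)
    (A : chart_id M -> M -> 'M[R]_m) (B : chart_id N -> N -> 'M[R]_k)
    (f : M -> N) :=
  forall p c d, dom c p -> dom d (f p) ->
    A c p *m dmx f c d p = dmx f c d p *m B d (f p).

Definition harmonic_map m k (M : manifold R m) (N : manifold R k)
    (g : chart_id M -> M -> 'M[R]_m) (h : chart_id N -> N -> 'M[R]_k)
    (f : M -> N) :=
  forall p c d, dom c p -> dom d (f p) ->
    tension (g c \o pnt c) (h d \o pnt d) (local_expr f c d) (crd c p) = 0.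

(** [[df o df^*, J] = 0]. *)
Definition PHWC m k (M : manifold R m) (N : manifold R k)
    (g : chart_id M -> M -> 'M[R]_m) (J h : chart_id N -> N -> 'M[R]_k)
    (f : M -> N) :=
  forall p c d, dom c p -> dom d (f p) ->
    let D := dmx f c d p in
    let DD := adjoint_mx (g c p) (h d (f p)) D *m D in
    DD *m J d (f p) = J d (f p) *m DD.

Definition harmonic_fun m (M : manifold R m) (g : chart_id M -> M -> 'M[R]_m)
    (V : set M) (f : M -> R[i]) :=
  forall p c, V p -> dom c p ->
    laplacian (g c \o pnt c) (@complex.Re R \o f \o pnt c : _ -> R) (crd c p) = 0 /\
    laplacian (g c \o pnt c) (@complex.Im R \o f \o pnt c : _ -> R) (crd c p) = 0.

Definition pseudo_harmonic_morphism m k (M : manifold R m) (N : manifold R k)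
    (g : chart_id M -> M -> 'M[R]_m) (J : chart_id N -> N -> 'M[R]_k)
    (f : M -> N) :=
  forall (V : set N) (w : N -> R[i]), open V -> holomorphic J V w ->
    harmonic_fun g (f @^-1` V) (w \o f).

Definition strong_pseudo_harmonic_morphism m n (M : manifold R m)
    (N : manifold R (n + n)) (g : chart_id M -> M -> 'M[R]_m)
    (J h : chart_id N -> N -> 'M[R]_(n + n)) (f : M -> N) :=
  kahler J h /\ pseudo_harmonic_morphism g J f.

(** [X], restricted to the open set [U], is an immersion and a homeomorphism
    onto a neighbourhood of [p] in [S]. *)
Record local_parametrization m (M : manifold R m) (S : set M) (p : M) k
    (U : set 'rV[R]_k) (X : 'rV[R]_k -> M) : Prop := {
  lp_open : open U;
  lp_point : exists2 u, U u & X u = p;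
  lp_image : exists2 W, open W & X @` U = S `&` W;
  lp_continuous : forall u, U u -> {for u, continuous X};
  lp_inverse : exists2 Y : M -> 'rV[R]_k, {within X @` U, continuous Y}
    & forall u, U u -> Y (X u) = u;
  lp_smooth : forall c, smooth (U `&` X @^-1` dom c) (crd c \o X);
  lp_immersion : forall u c, U u -> dom c (X u) ->
    row_free ('J (crd c \o X) u) }.

(** The mean curvature vector depends neither on the parametrization nor on
    the chart, so one parametrization around each point suffices. *)
Definition minimal_submanifold m (M : manifold R m)
    (g : chart_id M -> M -> 'M[R]_m) (S : set M) :=
  exists k, forall p, S p -> exists (U : set 'rV[R]_k) (X : 'rV[R]_k -> M),
    local_parametrization S p U X /\
    forall u c, U u -> dom c (X u) ->
      mean_curvature (g c \o pnt c) (crd c \o X) u = 0.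

(** A submanifold whose tangent spaces are stable under [J]. *)
Definition complex_submanifold m (N : manifold R m)
    (J : chart_id N -> N -> 'M[R]_m) (P : set N) :=
  exists k, forall q, P q -> exists (U : set 'rV[R]_k) (X : 'rV[R]_k -> N),
    local_parametrization P q U X /\
    forall u d, U u -> dom d (X u) ->
      stablemx ('J (crd d \o X) u) (J d (X u)).

End Manifolds.

(** The cone is [M x R_{>0}]. Its charts are the products of the charts of [M]
    with the coordinate [t]; the lemmas up to [cone] check that they define a
    smooth manifold. *)

Section SmoothTheory.
Variable R : realType.

Lemma continuous_mx (T : topologicalType) m n (f : T -> 'M[R]_(m, n)) (x : T) :
  (forall i j, {for x, continuous (fun t => f t i j : R)}) ->
  {for x, continuous f}.
Proof.
move=> cf A [/= P nP sPA].
have nf : forall i j, \forall t \near x, P i j (f t i j).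
  by move=> i j; apply: (cf i j); exact: nP.
have : \forall t \near x, forall i j, P i j (f t i j).
  by apply: filter_forall => i; apply: filter_forall => j; exact: nf.
by apply: filterS => t Pt; apply: sPA.
Qed.

Lemma continuous_mulmxr m n (A : 'M[R]_(m, n)) :
  continuous (mulmxr A : 'rV[R]_m -> 'rV[R]_n).
Proof.
move=> v; apply: continuous_mx => i j.
rewrite (_ : (fun _ => _) = \sum_(k < m) (fun w : 'rV[R]_m => w i k * A k j)).
  apply: differentiable_continuous; apply: differentiable_sum => k.
  by apply: differentiableM => //; exact: differentiable_coord.
by apply/funext => w; rewrite mxE fct_sumE.
Qed.

Lemma near_eq_differentiable (V W : normedModType R) (F G : V -> W) (x : V) :
  {near x, F =1 G} -> differentiable F x -> differentiable G x.
Proof.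
move=> FG dF; have cF := diff_continuous dF; have /diff_locally eF := dF.
have eG : G \o shift x = cst (G x) + 'd F x +o_ 0 id.
  apply/eqaddoP => _/posnumP[e].
  have /eqaddoP /(_ e%:num) /(_ [gt0 of e%:num]) := eF.
  have nFG : \forall h \near 0, F (h + x) = G (h + x).
    by move: FG; rewrite (near_shift 0 x) /=; apply: filterS => h; rewrite subr0.
  apply: filterS2 nFG => h /= eqh.
  by rewrite !fctE /= /cst eqh (nbhs_singleton FG).
by apply/diff_locallyP; rewrite (diff_unique cF eG).
Qed.

Lemma Ck_eq m (V : normedModType R) k (U : set 'rV[R]_m)
    (F G : 'rV[R]_m -> V) :
  open U -> (forall x, U x -> F x = G x) -> Ck k U F -> Ck k U G.
Proof.
move=> oU; elim: k F G => [|k IH] F G FG.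
  move=> cF x Ux; rewrite /prop_for /continuous_at -(FG x Ux); apply: cvg_trans (cF x Ux).
  apply: (@near_eq_cvg _ _ (nbhs x)); have : nbhs x U by exact: open_nbhs_nbhs.
  by move=> nU; near=> y; apply: FG; near: y.
have nFG x : U x -> {near x, F =1 G}.
  move=> Ux; have : nbhs x U by exact: open_nbhs_nbhs.
  by move=> nU; near=> y; apply: FG; near: y.
move=> [dF pF]; split=> [x Ux|i].
  by apply/(near_eq_differentiable (nFG x Ux)); exact: dF.
apply: (IH (partial i F)) => [x Ux|]; last exact: pF.
by apply: near_eq_derive; exact: nFG.
Unshelve. all: by end_near. Qed.

Lemma Ck_sub m (V : normedModType R) k (U W : set 'rV[R]_m)
    (F : 'rV[R]_m -> V) : W `<=` U -> Ck k U F -> Ck k W F.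
Proof.
move=> WU; elim: k F => [|k IH] F /=; first by move=> cF x /WU; exact: cF.
by move=> [dF pF]; split=> [x /WU|i]; [exact: dF | apply: IH; exact: pF].
Qed.

Lemma Ck_add m (V : normedModType R) k (U : set 'rV[R]_m)
    (F G : 'rV[R]_m -> V) : open U -> Ck k U F -> Ck k U G -> Ck k U (F + G).
Proof.
move=> oU; elim: k F G => [|k IH] F G /=.
  by move=> cF cG x Ux; apply: continuousD; [exact: cF | exact: cG].
move=> [dF pF] [dG pG]; split=> [x Ux|i].
  by apply: differentiableD; [exact: dF | exact: dG].
apply: (@Ck_eq _ _ _ _ (partial i F + partial i G)) => // [x Ux|].
  by rewrite /partial deriveD//; apply: diff_derivable; [exact: dF | exact: dG].
by apply: IH; [exact: pF | exact: pG].
Qed.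

Lemma Ck_linear_comp m (V W : normedModType R) k (U : set 'rV[R]_m)
    (L : {linear V -> W}) (F : 'rV[R]_m -> V) :
  open U -> continuous L -> Ck k U F -> Ck k U (L \o F).
Proof.
move=> oU cL; have dL x : differentiable L x by exact: linear_differentiable.
elim: k F => [|k IH] F /=.
  by move=> cF x Ux; apply: continuous_comp; [exact: cF | exact: cL].
move=> [dF pF]; split=> [x Ux|i].
  by apply: differentiable_comp => //; exact: dF.
apply: (@Ck_eq _ _ _ _ (L \o partial i F)) => // [x Ux|]; last by apply: IH; exact: pF.
have dFx := dF _ Ux; rewrite /partial deriveE; last exact: differentiable_comp.
by rewrite diff_comp// diff_lin//= deriveE.
Qed.

Lemma Ck_cst m (V : normedModType R) k (U : set 'rV[R]_m) (v : V) :
  Ck k U (cst v).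
Proof.
elim: k v => [|k IH] v /=; first by move=> x _; exact: cst_continuous.
split=> [x _|i]; first exact: differentiable_cst.
have -> : partial i (cst v : 'rV[R]_m -> V) = cst 0; last exact: IH.
by apply/funext => x; rewrite /partial derive_cst.
Qed.

Lemma Ck_linear m (V : normedModType R) k (U : set 'rV[R]_m)
    (L : {linear 'rV[R]_m -> V}) : open U -> continuous L -> Ck k U L.
Proof.
move=> oU cL; case: k => [x _|k /=]; first exact: cL.
split=> [x _|i]; first exact: linear_differentiable.
have -> : partial i L = cst (L (delta_mx 0 i)); last exact: Ck_cst.
apply/funext => x; rewrite /partial deriveE; last exact: linear_differentiable.
by rewrite diff_lin.
Qed.

Lemma Ck_lsubmx m n (V : normedModType R) k (U : set 'rV[R]_m)
    (F : 'rV[R]_m -> V) : open U -> Ck k U F ->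
  Ck k ((lsubmx : 'rV[R]_(m + n) -> 'rV[R]_m) @^-1` U) (F \o lsubmx).
Proof.
move=> oU.
have oU' : open ((lsubmx : 'rV[R]_(m + n) -> 'rV[R]_m) @^-1` U).
  by apply: open_comp => // x _; exact: continuous_lsubmx.
elim: k F => [|k IH] F /=.
  move=> cF x Ux; apply: continuous_comp; first exact: continuous_lsubmx.
  exact: cF.
move=> [dF pF]; split=> [x Ux|i].
  by apply: differentiable_comp; [exact: differentiable_lsubmx | exact: dF].
have dE x : U (lsubmx x) -> partial i (F \o lsubmx) x
    = 'D_(lsubmx (delta_mx 0 i : 'rV[R]_(m + n))) F (lsubmx x).
  move=> Ux; have dFx := dF _ Ux; have dl := @differentiable_lsubmx R 1 m n x.
  rewrite /partial deriveE; last exact: differentiable_comp.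
  rewrite diff_comp// (@diff_lin R _ _ lsubmx)/=; last exact: continuous_lsubmx.
  by rewrite deriveE.
case: (splitP i) => j ij.
  have ei : i = lshift n j by exact: val_inj.
  rewrite {}ei in dE *.
  apply: (@Ck_eq _ _ _ _ (partial j F \o lsubmx)) => // [x Ux|]; last by apply: IH; exact: pF.
  rewrite dE//= /partial; congr ('D_ _ _ _); apply/rowP => l.
  by rewrite !mxE eqxx eq_lshift.
have ei : i = rshift m j by exact: val_inj.
rewrite {}ei in dE *.
apply: (@Ck_eq _ _ _ _ (cst 0)) => // [x Ux|]; last exact: Ck_cst.
have dl0 : lsubmx (delta_mx 0 (rshift m j) : 'rV[R]_(m + n)) = 0.
  by apply/rowP => l; rewrite !mxE eqxx eq_lrshift.
by rewrite dE//= dl0 derive0.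
Qed.

End SmoothTheory.

Section ProductTopology.

Lemma hausdorff_prod (T U : topologicalType) :
  hausdorff_space T -> hausdorff_space U -> hausdorff_space (T * U)%type.
Proof.
move=> hT hU [p1 p2] [q1 q2] clpq; congr (_, _).
  apply: hT => A B nA nB.
  have nA' : nbhs (p1, p2) (fst @^-1` A) by apply: cvg_fst.
  have nB' : nbhs (q1, q2) (fst @^-1` B) by apply: cvg_fst.
  by have [[r1 r2] [/= Ar Br]] := clpq _ _ nA' nB'; exists r1.
apply: hU => A B nA nB.
have nA' : nbhs (p1, p2) (snd @^-1` A) by apply: cvg_snd.
have nB' : nbhs (q1, q2) (snd @^-1` B) by apply: cvg_snd.
by have [[r1 r2] [/= Ar Br]] := clpq _ _ nA' nB'; exists r2.
Qed.

Lemma open_setX (T U : topologicalType) (A : set T) (B : set U) :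
  open A -> open B -> open (A `*` B).
Proof.
rewrite !openE => oA oB [p q] [/= Ap Bq].
by exists (A, B) => //; split; [exact: oA | exact: oB].
Qed.

Lemma second_countable_prod (T U : topologicalType) :
  @second_countable T -> @second_countable U ->
  @second_countable (T * U)%type.
Proof.
move=> [B cB [oB bB]] [C cC [oC bC]].
exists [set P.1 `*` P.2 | P in B `*` C].
  by apply: (sub_countable (card_image_le _ _)); exact: countableX.
split=> [_ [[P Q] [/= BP CQ] <-]|[p q] A [[/= P Q] [nP nQ] sA]].
  by apply: open_setX; [exact: oB | exact: oC].
have [P' [BP' P'p] sP] := bB p _ nP; have [Q' [CQ' Q'q] sQ] := bC q _ nQ.
exists (P' `*` Q'); first by split=> //; exists (P', Q').
by move=> [x y] [/= P'x Q'y]; apply: sA; split; [exact: sP | exact: sQ].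
Qed.

End ProductTopology.

Section PositiveReals.
Variable R : realType.

Definition posreal : Type := set_type [set t : R | 0 < t].
HB.instance Definition _ := Topological.on posreal.

Definition posval (t : posreal) : R := \val t.

Lemma posval_gt0 (t : posreal) : 0 < posval t.
Proof. by case: t => t /= tP; exact: set_mem tP. Qed.

Definition posreal_of (t : R) : posreal :=
  if pselect ([set t : R | 0 < t] t) is left t0 then SigSub (mem_set t0)
  else SigSub (mem_set (ltr01 : [set t : R | 0 < t] 1)).

Lemma posreal_ofK (t : R) : 0 < t -> posval (posreal_of t) = t.
Proof. by rewrite /posreal_of; case: pselect. Qed.

Lemma posval_inj : injective posval. Proof. exact: val_inj. Qed.

Lemma posvalK (t : posreal) : posreal_of (posval t) = t.
Proof. by apply: posval_inj; rewrite posreal_ofK// posval_gt0. Qed.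

Lemma posval_continuous : continuous posval.
Proof. exact: initial_continuous. Qed.

Lemma posreal_of_continuous (t : R) : 0 < t -> {for t, continuous posreal_of}.
Proof.
move=> t0 A [_ [[B oB <-] Bt] sA].
have nB : nbhs t (B `&` [set t | 0 < t]).
  apply: open_nbhs_nbhs; split; first by apply: openI => //; exact: open_gt.
  by split=> //; rewrite -(posreal_ofK t0).
apply: filterS nB => s [Bs s0]; apply: sA.
by change (B (posval (posreal_of s))); rewrite posreal_ofK.
Qed.

Lemma posreal_hausdorff : hausdorff_space posreal.
Proof.
move=> s t cst; apply: posval_inj; apply: (@Rhausdorff R) => A B nA nB.
have [r [Ar Br]] := cst _ _ (posval_continuous nA) (posval_continuous nB).
by exists (posval r).
Qed.

Lemma posreal_second_countable : @second_countable posreal.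
Proof.
pose I (q : rat * rat) := posval @^-1` `]ratr q.1, ratr q.2[%classic.
exists (range I); first by apply: (sub_countable (card_image_le _ _)).
split=> [_ [q _ <-]|t A /= [_ [[B oB <-] Bt] sA]].
  apply: open_comp; last exact: itv_open.
  by move=> t _; exact: posval_continuous.
have /nbhs_ballP[e /= e0 eB] : nbhs (posval t) B by exact: open_nbhs_nbhs.
have lt1 : posval t - e < posval t by rewrite ltrBlDr ltrDl.
have lt2 : posval t < posval t + e by rewrite ltrDl.
have [a /itvP aI] := rat_in_itvoo lt1; have [b /itvP bI] := rat_in_itvoo lt2.
exists (I (a, b)).
  by split; [exists (a, b) | rewrite /I /= in_itv /= aI bI].
move=> s; rewrite /I /= in_itv /= => /andP[as_ sb]; apply: sA; apply: eB.
rewrite /ball/= ltr_distlC; apply/andP; split.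
  by apply: lt_trans as_; rewrite aI.
by apply: (lt_trans sb); rewrite bI.
Qed.

End PositiveReals.

Section Cone.
Variables (R : realType) (m : nat) (M : manifold R m).

Local Notation cone_points := (points M * posreal R)%type.

Section ConeChart.
Variable c : chart_id M.

Definition cone_dom : set cone_points := [set q | dom c q.1].

Definition cone_map (q : cone_points) : 'rV[R]_(m + 1) :=
  row_mx (crd c q.1) (posval q.2)%:M.

Definition cone_inv (y : 'rV[R]_(m + 1)) : cone_points :=
  (pnt c (lsubmx y), posreal_of (rsubmx y 0 0)).

Lemma cone_dom_open : open cone_dom.
Proof.
apply: open_comp; last exact: cdom_open.
by move=> q _; exact: cvg_fst.
Qed.

Lemma cone_mapK (q : cone_points) : cone_dom q -> cone_inv (cone_map q) = q.
Proof.
case: q => p t /= cp; rewrite /cone_inv row_mxKl row_mxKr mxE eqxx mulr1n.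
by rewrite posvalK /pnt cmapK.
Qed.

Lemma cone_image (A : set M) : A `<=` dom c ->
  cone_map @` [set q | A q.1] =
  (lsubmx @^-1` (crd c @` A)) `&` (fun y => rsubmx y 0 0) @^-1` [set t | 0 < t].
Proof.
move=> sA; apply/seteqP; split=> [_ [[p t] /= Ap <-]|y [/= [p Ap py] y0]].
  split; first by rewrite /= row_mxKl; exists p.
  by rewrite /= row_mxKr mxE eqxx mulr1n posval_gt0.
exists (p, posreal_of (rsubmx y 0 0)) => //.
by rewrite /cone_map /= posreal_ofK// py -mx11_scalar hsubmxK.
Qed.

Lemma rsubmx00_continuous : continuous (fun y : 'rV[R]_(m + 1) => rsubmx y 0 0).
Proof.
move=> y; apply: (@continuous_comp _ _ _ (rsubmx : 'rV[R]_(m + 1) -> 'rV[R]_1)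
  (fun v : 'rV[R]_1 => v 0 0)); first exact: continuous_rsubmx.
exact: coord_continuous.
Qed.

Lemma cone_img_open : open (cone_map @` cone_dom).
Proof.
rewrite cone_image//; apply: openI.
  apply: open_comp; last exact: cimg_open.
  by move=> y _; exact: continuous_lsubmx.
apply: open_comp; last exact: open_gt.
by move=> y _; exact: rsubmx00_continuous.
Qed.

Lemma cone_map_continuous (q : cone_points) :
  cone_dom q -> {for q, continuous cone_map}.
Proof.
case: q => p t /= cp; apply: continuous_mx => i j; rewrite ord1.
have c1 : {for (p, t), continuous (crd c \o (@fst M (posreal R)))}.
  apply: continuous_comp; first exact: cvg_fst.
  exact: (@cmap_continuous _ _ _ (charts c) p cp).
have c2 : {for (p, t), continuous (@posval R \o (@snd M (posreal R)))}.
  by apply: continuous_comp; [exact: cvg_snd | exact: posval_continuous].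
case: (splitP j) => k jk.
  have -> : j = lshift 1 k by exact: val_inj.
  rewrite (_ : (fun _ => _) = (fun v : 'rV[R]_m => v 0 k) \o
      (crd c \o (@fst M (posreal R)))).
    apply: (@continuous_comp _ _ _ (crd c \o (@fst M (posreal R)))
      (fun v : 'rV[R]_m => v 0 k)); [exact: c1 | exact: coord_continuous].
  by apply/funext => q; rewrite /cone_map row_mxEl.
have -> : j = rshift m k by exact: val_inj.
rewrite (_ : (fun _ => _) = @posval R \o (@snd M (posreal R))); first exact: c2.
by apply/funext => q; rewrite /cone_map row_mxEr mxE ord1 eqxx mulr1n.
Qed.

Lemma cone_inv_continuous (q : cone_points) :
  cone_dom q -> {for cone_map q, continuous cone_inv}.
Proof.
case: q => p t /= cp; set y := cone_map (p, t).
have c1 : {for y, continuous (pnt c \o (lsubmx : 'rV[R]_(m + 1) -> 'rV[R]_m))}.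
  apply: continuous_comp; first exact: continuous_lsubmx.
  by rewrite /y /cone_map row_mxKl; exact: cinv_continuous.
have c2 : {for y, continuous
    (@posreal_of R \o (fun v : 'rV[R]_(m + 1) => rsubmx v 0 0))}.
  apply: continuous_comp; first exact: rsubmx00_continuous.
  apply: posreal_of_continuous.
  by rewrite /y /cone_map row_mxKr mxE eqxx mulr1n posval_gt0.
exact: (cvg_pair c1 c2).
Qed.

Definition cone_chart : chart R cone_points (m + 1) :=
  Chart cone_dom_open cone_img_open cone_mapK cone_map_continuous
    cone_inv_continuous.

End ConeChart.

Lemma cone_charts_cover (q : cone_points) : exists c, cdom (cone_chart c) q.
Proof. by have [c cp] := charts_cover q.1; exists c. Qed.

Lemma open_change (c d : chart_id M) : open (crd c @` (dom c `&` dom d)).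
Proof.
rewrite (_ : _ @` _ = (crd c @` dom c) `&` (pnt c @^-1` dom d)).
  rewrite openE => x [[p cp <-]] /= dp.
  apply: filterI; first by apply: open_nbhs_nbhs; split; [exact: cimg_open | exists p].
  apply: (cinv_continuous cp); rewrite cmapK//.
  by apply: open_nbhs_nbhs; split; [exact: cdom_open | rewrite /pnt /crd cmapK in dp].
apply/seteqP; split=> [_ [p [cp dp] <-]|_ [[p cp <-]] /=].
  by split; [exists p | rewrite /= /pnt /crd cmapK].
by rewrite /pnt /crd cmapK// => dp; exists p.
Qed.

Lemma cone_charts_smooth (c d : chart_id M) :
  smooth_change (cone_chart c) (cone_chart d).
Proof.
pose W := crd c @` (dom c `&` dom d).
pose pr := (lsubmx : 'rV[R]_(m + 1) -> 'rV[R]_m).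
pose U := (pr @^-1` W)
  `&` (fun y : 'rV[R]_(m + 1) => rsubmx y 0 0) @^-1` [set t | 0 < t].
have oW : open W by exact: open_change.
have opW : open (pr @^-1` W).
  by apply: open_comp => // y _; exact: continuous_lsubmx.
have oU : open U.
  apply: openI => //; apply: open_comp; last exact: open_gt.
  by move=> y _; exact: rsubmx00_continuous.
have eU : cmap (cone_chart c) @` (cdom (cone_chart c) `&` cdom (cone_chart d)) = U.
  by apply: (@cone_image c (dom c `&` dom d)) => p [].
move=> k; rewrite eU.
pose L1 : {linear 'rV[R]_m -> 'rV[R]_(m + 1)} := mulmxr (row_mx 1%:M 0).
pose L2 : {linear 'rV[R]_(m + 1) -> 'rV[R]_(m + 1)} :=
  mulmxr (block_mx 0 0 0 1%:M).
have s1 : Ck k U (L1 \o ((crd d \o pnt c) \o pr)).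
  apply: Ck_linear_comp => //; first exact: continuous_mulmxr.
  apply: (@Ck_sub _ _ _ _ (pr @^-1` W)); first by move=> y [].
  by apply: Ck_lsubmx => //; exact: charts_smooth.
have s2 : Ck k U L2 by apply: Ck_linear => //; exact: continuous_mulmxr.
apply: (Ck_eq oU _ (Ck_add oU s1 s2)) => y [Wy y0].
transitivity (crd d (pnt c (lsubmx y)) *m row_mx 1%:M 0
  + row_mx (lsubmx y) (rsubmx y) *m block_mx 0 0 0 1%:M); first by rewrite hsubmxK.
rewrite mul_mx_row mulmx1 mulmx0 mul_row_block.
rewrite !mulmx0 !add0r mulmx1 add_row_mx addr0 add0r.
rewrite -[RHS]/(cone_map d (cone_inv c y)) /cone_map /= posreal_ofK//.
by rewrite -mx11_scalar.
Qed.


Definition cone : manifold R (m + 1) :=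
  Manifold (hausdorff_prod (@mf_hausdorff _ _ M) (@posreal_hausdorff R))
    (second_countable_prod (@mf_second_countable _ _ M)
      (@posreal_second_countable R))
    cone_charts_cover cone_charts_smooth.

Definition cone_proj (q : cone) : M := q.1.

(** Components in the chart [(x, t)] of the cone, last coordinate [d/dt]. *)

(** [dt (x) dt + t^2 g]. *)
Definition cone_metric (g : chart_id M -> M -> 'M[R]_m) (c : chart_id cone)
    (q : cone) : 'M[R]_(m + 1) :=
  block_mx (posval q.2 ^+ 2 *: g c q.1) 0 0 1%:M.

(** [J (X, f d/dt) = (phi X - f xi, eta(X) d/dt)]; see [cone_JE]. *)
Definition cone_J (phi : chart_id M -> M -> 'M[R]_m)
    (xi : chart_id M -> M -> 'rV[R]_m) (eta : chart_id M -> M -> 'cV[R]_m)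
    (c : chart_id cone) (q : cone) : 'M[R]_(m + 1) :=
  block_mx (phi c q.1) (eta c q.1) (- xi c q.1) 0.

Lemma cone_JE phi xi eta c q (X : 'rV[R]_m) (f : R) :
  row_mx X f%:M *m cone_J phi xi eta c q
  = row_mx (X *m phi c q.1 - f *: xi c q.1) (X *m eta c q.1).
Proof. by rewrite mul_row_block mulmx0 addr0 mulmxN mul_scalar_mx. Qed.

End Cone.

(* Main.v *)
Require Import Defs.
From HB Require Import structures.
From mathcomp Require Import all_boot all_order all_algebra.
From mathcomp Require Import all_classical all_reals topology normedtype derive.
From mathcomp Require Import complex.
Set Implicit Arguments.
Unset Strict Implicit.
Unset Printing Implicit Defensive.
Import Order.TTheory GRing.Theory Num.Theory.
Import numFieldNormedType.Exports.
Local Open Scope classical_set_scope.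
Local Open Scope ring_scope.

(** In a product chart [(x, t)] the map [f \o cone_proj] does not depend on [t],
    the lines [t |-> (x, t)] are geodesics of [dt^2 + t^2 g], and the components
    along [M] of the Christoffel symbols of the cone are those of [g].  Hence
    traces of Hessians of functions pulled back from [M] get multiplied by
    [t^-2], as does [df o df^*]; this gives the parts on harmonicity.  Likewise
    the mean curvature vector of the cone over a submanifold [S] is [t^-2] times
    that of [S]: the radial component [- t g(v, w)] of the Christoffel form is
    tangent to the cone.  Finally [J] intertwines with [JN] when [phi] does and
    [df(xi) = 0], and the latter follows from [phi xi = 0]. *)

(** * Partial derivatives and Jacobians in product coordinates *)

Section Calculus.
Variable R : realType.
Implicit Types m n k : nat.

(** The two difference quotients coincide term by term, so the identity holds even where the limit
    does not exist. *)
Lemma derive_row_mxl m n (V : normedModType R) (F : 'rV[R]_(m + n) -> V)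
    (x v : 'rV[R]_m) (s : 'rV[R]_n) :
  'D_(row_mx v 0) F (row_mx x s) = 'D_v (fun z => F (row_mx z s)) x.
Proof.
rewrite /derive; by under eq_fun do rewrite /= scale_row_mx add_row_mx scaler0 add0r.
Qed.

Lemma derive_row_mxr m n (V : normedModType R) (F : 'rV[R]_(m + n) -> V)
    (x : 'rV[R]_m) (s w : 'rV[R]_n) :
  'D_(row_mx 0 w) F (row_mx x s) = 'D_w (fun z => F (row_mx x z)) s.
Proof.
rewrite /derive; by under eq_fun do rewrite /= scale_row_mx add_row_mx scaler0 add0r.
Qed.

Lemma partial_lshift m n (V : normedModType R) (F : 'rV[R]_(m + n) -> V)
    (i : 'I_m) (y : 'rV[R]_(m + n)) :
  partial (lshift n i) F y
  = partial i (fun z => F (row_mx z (rsubmx y))) (lsubmx y).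
Proof. by rewrite /partial delta_mx_lshift -[in LHS](hsubmxK y) derive_row_mxl. Qed.

Lemma partial_rshift m n (V : normedModType R) (F : 'rV[R]_(m + n) -> V)
    (i : 'I_n) (y : 'rV[R]_(m + n)) :
  partial (rshift m i) F y
  = partial i (fun z => F (row_mx (lsubmx y) z)) (rsubmx y).
Proof. by rewrite /partial delta_mx_rshift -[in LHS](hsubmxK y) derive_row_mxr. Qed.

Lemma partial_cst m (V : normedModType R) (i : 'I_m) (v : V) :
  partial i (cst v) = cst 0.
Proof. by apply/funext => x; rewrite /partial derive_cst. Qed.

(** An equality of functions rather than of values, so that it can also be used under a second
    partial derivative. *)
Lemma partial_lsubmx_lshift m n (V : normedModType R) (F : 'rV[R]_m -> V)
    (i : 'I_m) :
  partial (lshift n i) (F \o lsubmx) = partial i F \o lsubmx.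
Proof.
apply/funext => y; rewrite partial_lshift /=; congr (partial _ _ _).
by apply/funext => z /=; rewrite row_mxKl.
Qed.

Lemma partial_lsubmx_rshift m n (V : normedModType R) (F : 'rV[R]_m -> V)
    (i : 'I_n) :
  partial (rshift m i) (F \o lsubmx) = cst 0.
Proof.
apply/funext => y; rewrite partial_rshift /= (_ : (fun _ => _) = cst (F (lsubmx y))).
  by rewrite partial_cst.
by apply/funext => z /=; rewrite row_mxKl.
Qed.

Lemma row_jacobian m n (F : 'rV[R]_m -> 'rV[R]_n) (x : 'rV[R]_m) (i : 'I_m) :
  differentiable F x -> row i ('J F x) = partial i F x.
Proof. by move=> dF; rewrite rowE -deriveEjacobian. Qed.

Lemma jacobian_near_eq m n (F G : 'rV[R]_m -> 'rV[R]_n) (x : 'rV[R]_m) :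
  {near x, F =1 G} -> differentiable F x -> 'J F x = 'J G x.
Proof.
move=> FG dF; have dG := near_eq_differentiable FG dF.
apply/row_matrixP => i; rewrite [LHS](row_jacobian i dF) [RHS](row_jacobian i dG).
exact: near_eq_derive.
Qed.

Lemma jacobian_lsubmx m n k (F : 'rV[R]_m -> 'rV[R]_k) (y : 'rV[R]_(m + n)) :
  differentiable F (lsubmx y) ->
  'J (F \o lsubmx) y = col_mx ('J F (lsubmx y)) 0.
Proof.
move=> dF; have dFl : differentiable (F \o lsubmx) y.
  by apply: differentiable_comp; first exact: differentiable_lsubmx.
apply/row_matrixP => i; rewrite [LHS](row_jacobian i dFl); case: (splitP i) => j ij.
  have -> : i = lshift n j by exact: val_inj.
  by rewrite rowKu partial_lsubmx_lshift [RHS](row_jacobian _ dF).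
have -> : i = rshift m j by exact: val_inj.
by rewrite rowKd partial_lsubmx_rshift row0.
Qed.

Lemma partialZ m (V : normedModType R) (a : R) (F : 'rV[R]_m -> V)
    (x : 'rV[R]_m) (i : 'I_m) :
  differentiable F x -> partial i (fun z => a *: F z) x = a *: partial i F x.
Proof. by move=> dF; exact/deriveZ/diff_derivable. Qed.

Lemma partial_linear_comp m (V W : normedModType R) (L : {linear V -> W})
    (F : 'rV[R]_m -> V) (x : 'rV[R]_m) (i : 'I_m) :
  continuous L -> differentiable F x ->
  partial i (L \o F) x = L (partial i F x).
Proof.
move=> cL dF; have dL z : differentiable L z by exact: linear_differentiable.
rewrite /partial deriveE; last exact: differentiable_comp.
by rewrite diff_comp// diff_lin//= deriveE.
Qed.

Lemma mx_coord_differentiable m k l (G : 'rV[R]_m -> 'M[R]_(k, l))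
    (x : 'rV[R]_m) i j :
  differentiable G x -> differentiable (fun z => G z i j : R) x.
Proof.
move=> dG; apply: (@differentiable_comp _ _ _ _ G (fun A : 'M[R]_(k, l) => A i j)) => //.
exact: differentiable_coord.
Qed.

End Calculus.

(** * Traces against the inverse of a block diagonal metric *)

Section ScaledBlock.
Variables (R : fieldType) (m : nat) (c : R) (A : 'M[R]_m).
Hypotheses (c_neq0 : c != 0) (unitA : A \in unitmx).
Local Notation B := (block_mx (c *: A) 0 0 1%:M : 'M[R]_(m + 1)).

Lemma invmx_scaled_block :
  invmx B = block_mx (c^-1 *: invmx A) 0 0 1%:M.
Proof.
have uA : c *: A \in unitmx by rewrite unitmxZ// unitfE.
rewrite invmx_block_diag ?block_diag_mx_unit ?uA ?unitmx1//.
by rewrite invmxZ// invmx1.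
Qed.

Lemma invmx_scaled_blockul i j :
  invmx B (lshift 1 i) (lshift 1 j) = c^-1 * invmx A i j.
Proof. by rewrite invmx_scaled_block block_mxEul mxE. Qed.

Lemma invmx_scaled_blockur i j : invmx B (lshift 1 i) (rshift m j) = 0.
Proof. by rewrite invmx_scaled_block block_mxEur mxE. Qed.

Lemma invmx_scaled_blockdl i j : invmx B (rshift m i) (lshift 1 j) = 0.
Proof. by rewrite invmx_scaled_block block_mxEdl mxE. Qed.

(** The inverse of [B] has no mixed entries, so only the horizontal block of [T] and its fibre entry
    are seen. The Laplacian, the tension field and the mean curvature all get their factor [c^-1]
    from here. *)
Lemma trace_scaled_block (V : lmodType R) (T : 'I_(m + 1) -> 'I_(m + 1) -> V)
    (S : 'I_m -> 'I_m -> V) :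
  (forall i j, T (lshift 1 i) (lshift 1 j) = S i j) ->
  T (rshift m 0) (rshift m 0) = 0 ->
  \sum_i \sum_j invmx B i j *: T i j
  = c^-1 *: \sum_i \sum_j invmx A i j *: S i j.
Proof.
move=> TS T0; rewrite big_split_ord /= big_ord1.
rewrite [X in _ + X]big_split_ord /= big_ord1 T0 scaler0 addr0.
rewrite [X in _ + X]big1 ?addr0 => [|j _]; last first.
  by rewrite invmx_scaled_blockdl scale0r.
rewrite scaler_sumr; apply: eq_bigr => i _.
rewrite big_split_ord /= big_ord1 invmx_scaled_blockur scale0r addr0.
rewrite scaler_sumr; apply: eq_bigr => j _.
by rewrite invmx_scaled_blockul TS scalerA.
Qed.

End ScaledBlock.

(** * Connection and Hessians of a warped product metric *)

Section Warped.
Variables (R : realType) (m : nat) (s : R -> R) (G : 'rV[R]_m -> 'M[R]_m).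

(** The metric [s(t) G(x) + dt^2]. The warping function can stay arbitrary because its derivative
    enters only the mixed Christoffel symbols and the radial components, and none of these is
    needed. *)
Definition warp (y : 'rV[R]_(m + 1)) : 'M[R]_(m + 1) :=
  block_mx (s (rsubmx y 0 0) *: G (lsubmx y)) 0 0 1%:M.

Variable y : 'rV[R]_(m + 1).
Hypothesis s_neq0 : s (rsubmx y 0 0) != 0.
Hypothesis unitG : G (lsubmx y) \in unitmx.

Hypothesis diffG : differentiable G (lsubmx y).

Lemma partial_warp (a i j : 'I_m) :
  partial (lshift 1 a) (fun z => warp z (lshift 1 i) (lshift 1 j) : R) y
  = s (rsubmx y 0 0) * partial a (fun x => G x i j : R) (lsubmx y).
Proof.
rewrite partial_lshift -[RHS]partialZ; last exact: mx_coord_differentiable.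
apply: (congr1 (fun F => partial a F (lsubmx y))); apply/funext => x.
by rewrite /warp row_mxKl row_mxKr block_mxEul mxE.
Qed.

(** Derivatives along [M] of the horizontal block carry a factor [s], which cancels the [s^-1] of
    the inverse metric. The radial summation index meets a zero entry of that inverse. *)
Lemma christoffel_warp (i j : 'I_m) :
  lsubmx (christoffel warp y (lshift 1 i) (lshift 1 j))
  = christoffel G (lsubmx y) i j.
Proof.
apply/rowP => a; rewrite !mxE; congr (_ * _).
rewrite big_split_ord /= big_ord1 (invmx_scaled_blockur s_neq0 unitG) mul0r addr0.
apply: eq_bigr => l _; rewrite (invmx_scaled_blockul s_neq0 unitG) !partial_warp.
rewrite -mulrDr -mulrBr mulrACA [_ * s _]mulrC !mulrA.
by rewrite divff// mul1r.
Qed.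

(** The entries of the metric in the fibre row are the constants 0 and 1, so every derivative in
    these symbols vanishes. *)
Lemma christoffel_warp_fiber :
  lsubmx (christoffel warp y (rshift m 0) (rshift m 0)) = 0.
Proof.
apply/rowP => a; rewrite !mxE big_split_ord /= big_ord1.
rewrite (invmx_scaled_blockur s_neq0 unitG) mul0r addr0 big1 ?mulr0// => l _.
have -> : (fun z => warp z (rshift m 0) (lshift 1 l) : R) = cst 0.
  by apply/funext => z; rewrite /warp block_mxEdl mxE.
have -> : (fun z => warp z (rshift m 0) (rshift m 0) : R) = cst 1.
  by apply/funext => z; rewrite /warp block_mxEdr mxE eqxx.
by rewrite !partial_cst /cst /= addr0 subr0 mulr0.
Qed.

Lemma christoffel_form_warp (v w : 'rV[R]_m) :
  lsubmx (christoffel_form warp y (row_mx v 0) (row_mx w 0))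
  = christoffel_form G (lsubmx y) v w.
Proof.
rewrite /christoffel_form big_split_ord /= big_ord1.
rewrite [X in _ + X]big1 ?addr0 => [|j _]; last first.
  by rewrite row_mxEr mxE mul0r scale0r.
rewrite linear_sum; apply: eq_bigr => i _.
rewrite big_split_ord /= big_ord1 row_mxEr [X in _ * X]mxE mulr0 scale0r addr0.
rewrite linear_sum; apply: eq_bigr => j _.
by rewrite linearZ /= !row_mxEl christoffel_warp.
Qed.

Lemma christoffel_form_warp_fiber (v w : 'rV[R]_1) :
  lsubmx (christoffel_form warp y (row_mx 0 v) (row_mx 0 w)) = 0.
Proof.
rewrite /christoffel_form big_split_ord /= big_ord1.
rewrite [X in X + _]big1 ?add0r => [|j _]; last first.
  by rewrite big1// => i _; rewrite row_mxEl mxE mul0r scale0r.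
rewrite big_split_ord /= big_ord1 big1 ?add0r => [|j _].
  by rewrite linearZ /= christoffel_warp_fiber scaler0.
by rewrite row_mxEl [X in _ * X]mxE mulr0 scale0r.
Qed.

(** A pulled back function has no radial derivative, so the radial component of the Christoffel
    symbol is paired with 0. *)
Lemma hessian_warp (V : normedModType R) (F : 'rV[R]_m -> V) (i j : 'I_m) :
  hessian warp (F \o lsubmx) y (lshift 1 i) (lshift 1 j)
  = hessian G F (lsubmx y) i j.
Proof.
rewrite /hessian !partial_lsubmx_lshift /=; congr (_ - _).
rewrite big_split_ord /= big_ord1 partial_lsubmx_rshift /cst /= scaler0 addr0.
apply: eq_bigr => a _; rewrite partial_lsubmx_lshift /= -christoffel_warp.
by rewrite [in RHS]mxE.
Qed.

Lemma hessian_warp_fiber (V : normedModType R) (F : 'rV[R]_m -> V) :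
  hessian warp (F \o lsubmx) y (rshift m 0) (rshift m 0) = 0.
Proof.
rewrite /hessian !partial_lsubmx_rshift partial_cst /cst /= sub0r.
apply/eqP; rewrite oppr_eq0 big_split_ord /= big_ord1.
rewrite partial_lsubmx_rshift /cst /= scaler0 addr0 big1// => a _.
move/rowP/(_ a): christoffel_warp_fiber; rewrite mxE => ->.
by rewrite mxE scale0r.
Qed.

Lemma laplacian_warp (u : 'rV[R]_m -> R) :
  laplacian warp (u \o lsubmx) y
  = (s (rsubmx y 0 0))^-1 * laplacian G u (lsubmx y).
Proof.
apply: (trace_scaled_block s_neq0 unitG) => [i j|]; first exact: hessian_warp.
exact: hessian_warp_fiber.
Qed.

Lemma tension_warp k (H : 'rV[R]_k -> 'M[R]_k) (F : 'rV[R]_m -> 'rV[R]_k) :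
  tension warp H (F \o lsubmx) y
  = (s (rsubmx y 0 0))^-1 *: tension G H F (lsubmx y).
Proof.
apply: (trace_scaled_block s_neq0 unitG) => [i j|].
  by rewrite hessian_warp !partial_lsubmx_lshift.
(* The Christoffel term of the target is bilinear in the derivatives of the map, and the radial
   derivative is 0. *)
rewrite hessian_warp_fiber partial_lsubmx_rshift add0r /christoffel_form.
by rewrite big1// => a _; rewrite big1// => b _; rewrite mxE mul0r scale0r.
Qed.

End Warped.

(** * Suspension of a parametrization *)

Section Suspension.
Variable R : realType.
Implicit Types m k : nat.

(** The product of [F] with the identity of the last coordinate: in charts, the cone over the
    submanifold parametrized by [F]. *)
Definition susp k m (F : 'rV[R]_k -> 'rV[R]_m) (y : 'rV[R]_(k + 1)) :
  'rV[R]_(m + 1) := row_mx (F (lsubmx y)) (rsubmx y).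

Definition susp_left m : {linear 'rV[R]_m -> 'rV[R]_(m + 1)} :=
  mulmxr (row_mx 1%:M 0).

Definition susp_right k m : {linear 'rV[R]_(k + 1) -> 'rV[R]_(m + 1)} :=
  mulmxr (block_mx 0 0 0 1%:M).

Lemma susp_leftE m (v : 'rV[R]_m) : susp_left m v = row_mx v 0.
Proof. by rewrite /= mul_mx_row mulmx1 mulmx0. Qed.

Lemma susp_rightE k m (y : 'rV[R]_(k + 1)) :
  susp_right k m y = row_mx 0 (rsubmx y).
Proof.
rewrite /= -[in LHS](hsubmxK y) mul_row_block.
by rewrite !mulmx0 mulmx1 !add0r.
Qed.

(** Writes the suspension with continuous linear maps only, so that its regularity and its
    derivatives reduce to those of [F \o lsubmx]. *)
Lemma suspE k m (F : 'rV[R]_k -> 'rV[R]_m) :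
  susp F = susp_left m \o (F \o lsubmx) + susp_right k m.
Proof.
apply/funext => y.
rewrite -[RHS]/(susp_left m (F (lsubmx y)) + susp_right k m y).
by rewrite susp_leftE susp_rightE add_row_mx addr0 add0r.
Qed.

Lemma Ck_susp k m j (U : set 'rV[R]_k) (F : 'rV[R]_k -> 'rV[R]_m) :
  open U -> Ck j U F ->
  Ck j ((lsubmx : 'rV[R]_(k + 1) -> 'rV[R]_k) @^-1` U) (susp F).
Proof.
move=> oU sF; rewrite suspE.
have oU' : open ((lsubmx : 'rV[R]_(k + 1) -> 'rV[R]_k) @^-1` U).
  by apply: open_comp => // x _; exact: continuous_lsubmx.
apply: Ck_add => //; last by apply: Ck_linear => //; exact: continuous_mulmxr.
apply: Ck_linear_comp => //; first exact: continuous_mulmxr.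
exact: Ck_lsubmx.
Qed.

Lemma differentiable_susp k m (F : 'rV[R]_k -> 'rV[R]_m) (y : 'rV[R]_(k + 1)) :
  differentiable F (lsubmx y) -> differentiable (susp F) y.
Proof.
move=> dF; rewrite suspE; apply: differentiableD; last first.
  by apply: linear_differentiable; exact: continuous_mulmxr.
apply: differentiable_comp.
  by apply: differentiable_comp => //; exact: differentiable_lsubmx.
by apply: linear_differentiable; exact: continuous_mulmxr.
Qed.

Lemma partial_susp k m (F : 'rV[R]_k -> 'rV[R]_m) (y : 'rV[R]_(k + 1)) i :
  differentiable F (lsubmx y) ->
  partial i (susp F) y
  = row_mx (partial i (F \o lsubmx) y) (rsubmx (delta_mx 0 i : 'rV[R]_(k + 1))).
Proof.
move=> dF; have dFl : differentiable (F \o lsubmx) y.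
  by apply: differentiable_comp => //; exact: differentiable_lsubmx.
have cl := @continuous_mulmxr R m (m + 1) (row_mx 1%:M 0).
have cr := @continuous_mulmxr R (k + 1) (m + 1) (block_mx 0 0 0 1%:M).
have dr : differentiable (susp_right k m) y by exact: linear_differentiable.
rewrite suspE /partial deriveD; last 2 first.
- apply: diff_derivable; apply: differentiable_comp => //.
  exact: linear_differentiable.
- exact: diff_derivable.
rewrite [X in X + _](@partial_linear_comp _ _ _ _ (susp_left m)) //.
rewrite susp_leftE (deriveE _ dr) diff_lin// susp_rightE.
by rewrite add_row_mx addr0 add0r.
Qed.

Lemma partial_susp_lshift k m (F : 'rV[R]_k -> 'rV[R]_m) (y : 'rV[R]_(k + 1)) i :
  differentiable F (lsubmx y) ->
  partial (lshift 1 i) (susp F) y = row_mx (partial i F (lsubmx y)) 0.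
Proof.
move=> dF; rewrite partial_susp// partial_lsubmx_lshift.
by rewrite delta_mx_lshift row_mxKr.
Qed.

Lemma partial_susp_rshift k m (F : 'rV[R]_k -> 'rV[R]_m) (y : 'rV[R]_(k + 1)) i :
  differentiable F (lsubmx y) ->
  partial (rshift k i) (susp F) y = row_mx 0 (delta_mx 0 i).
Proof.
move=> dF; rewrite partial_susp// partial_lsubmx_rshift.
by rewrite delta_mx_rshift row_mxKr.
Qed.

Lemma jacobian_susp k m (F : 'rV[R]_k -> 'rV[R]_m) (y : 'rV[R]_(k + 1)) :
  differentiable F (lsubmx y) ->
  'J (susp F) y = block_mx ('J F (lsubmx y)) 0 0 1%:M.
Proof.
move=> dF; have dS := differentiable_susp dF.
apply/row_matrixP => i; rewrite [LHS](row_jacobian i dS).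
case: (splitP i) => j ij.
  have -> : i = lshift 1 j by exact: val_inj.
  rewrite partial_susp_lshift// /block_mx rowKu row_row_mx row0.
  by congr row_mx; apply/esym; exact: row_jacobian.
have -> : i = rshift k j by exact: val_inj.
by rewrite partial_susp_rshift// /block_mx rowKd row_row_mx row0 rowE mulmx1.
Qed.

End Suspension.

(** * Mean curvature of a suspension in a warped product *)

Section MeanCurvature.
Variables (R : realType) (m k : nat).

(** Mean curvature depends only on the germ of the parametrization. This is needed because a
    parametrization of the cone agrees with a suspension only where [t > 0]. *)
Lemma mean_curvature_near_eq (G : 'rV[R]_m -> 'M[R]_m)
    (X Y : 'rV[R]_k -> 'rV[R]_m) (u : 'rV[R]_k) :
  {near u, X =1 Y} -> differentiable X u ->
  mean_curvature G X u = mean_curvature G Y u.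
Proof.
move=> XY dX; have eXY := nbhs_singleton XY.
have eJ := jacobian_near_eq XY dX.
have ep a : {near u, partial a X =1 partial a Y}.
  (* Second derivatives need the first ones to agree on a neighbourhood, hence germ equality at
     every nearby point. *)
  move/near_join: XY; apply: filterS => v; exact: near_eq_derive.
have eI : first_form G X u = first_form G Y u by rewrite /first_form eXY eJ.
have eII a b : second_form G X u a b = second_form G Y u a b.
  rewrite /second_form /normal_part eI eXY eJ !(nbhs_singleton (ep _)).
  by rewrite [partial a (partial b X) u](near_eq_derive _ (ep b)).
rewrite /mean_curvature eI.
by apply: eq_bigr => a _; apply: eq_bigr => b _; rewrite eII.
Qed.

Variables (s : R -> R) (G : 'rV[R]_m -> 'M[R]_m) (F : 'rV[R]_k -> 'rV[R]_m).
Variables (U : set 'rV[R]_k) (y : 'rV[R]_(k + 1)).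
Local Notation u := (lsubmx y).
Hypotheses (oU : open U) (sF : Ck 2 U F) (Uu : U u).
Hypotheses (s_neq0 : s (rsubmx y 0 0) != 0) (unitG : G (F u) \in unitmx).
Hypotheses (diffG : differentiable G (F u)) (unitI : first_form G F u \in unitmx).

Let dF v : U v -> differentiable F v.
Proof. by case: sF => dF _; exact: dF. Qed.

Let dpF v a : U v -> differentiable (partial a F) v.
Proof. by case: sF => _ /(_ a)[dpF _]; exact: dpF. Qed.

Let nearU : \forall z \near y, U (lsubmx z).
Proof.
apply: open_nbhs_nbhs; split=> //.
by apply: open_comp => // x _; exact: continuous_lsubmx.
Qed.

Let warp_susp :
  warp s G (susp F y) = block_mx (s (rsubmx y 0 0) *: G (F u)) 0 0 1%:M.
Proof. by rewrite /warp /susp row_mxKl row_mxKr. Qed.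

(** The induced metric is again of warped shape, so the block inverse and trace lemmas apply to it
    too. *)
Lemma first_form_susp :
  first_form (warp s G) (susp F) y
  = block_mx (s (rsubmx y 0 0) *: first_form G F u) 0 0 1%:M.
Proof.
rewrite /first_form warp_susp jacobian_susp; last exact: dF.
rewrite mulmx_block tr_block_mx !trmx0 trmx1 mulmx_block.
rewrite !(mulmx0, mul0mx, addr0, add0r, mulmx1).
by rewrite -scalemxAr -scalemxAl.
Qed.

(** The radial direction is tangent to the suspension and is projected away. In the other directions
    the factor [s] of the metric cancels that of the inverse first form. *)
Lemma normal_part_susp (v : 'rV[R]_(m + 1)) :
  normal_part (warp s G) (susp F) y v = row_mx (normal_part G F u (lsubmx v)) 0.
Proof.
rewrite /normal_part first_form_susp invmx_scaled_block//.
rewrite warp_susp jacobian_susp; last exact: dF.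
rewrite -{1 2}(hsubmxK v) tr_block_mx !trmx0 trmx1 !mul_row_block.
rewrite !(mulmx0, mul0mx, addr0, add0r, mulmx1).
rewrite opp_row_mx add_row_mx subrr; congr (row_mx (_ - _) _).
by rewrite -!scalemxAr -!scalemxAl scalerA mulVf// scale1r.
Qed.

Lemma second_form_susp a b :
  second_form (warp s G) (susp F) y (lshift 1 a) (lshift 1 b)
  = row_mx (second_form G F u a b) 0.
Proof.
rewrite /second_form normal_part_susp; congr (row_mx (normal_part _ _ _ _) _).
have -> : partial (lshift 1 a) (partial (lshift 1 b) (susp F)) y
    = row_mx (partial a (partial b F) u) 0.
  (* Near [y] the inner derivative is a linear image of [partial b F \o lsubmx], so the outer
     derivative passes through the linear map. *)
  transitivity (partial (lshift 1 a) (susp_left R m \o (partial b F \o lsubmx)) y).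
    apply: near_eq_derive; apply: filterS nearU => z Uz.
    rewrite partial_susp_lshift; last exact: dF.
    exact/esym/susp_leftE.
  rewrite partial_linear_comp.
  - by rewrite susp_leftE partial_lsubmx_lshift.
  - exact: continuous_mulmxr.
  - by apply: differentiable_comp; [exact: differentiable_lsubmx | exact: dpF].
rewrite !partial_susp_lshift; try exact: dF.
rewrite linearD /= row_mxKl christoffel_form_warp ?row_mxKl ?row_mxKr//.
Qed.

(** The radial coordinate lines have constant velocity, and the fibre Christoffel form has no
    component along [M]. *)
Lemma second_form_susp_fiber :
  second_form (warp s G) (susp F) y (rshift k 0) (rshift k 0) = 0.
Proof.
rewrite /second_form normal_part_susp.
have -> : partial (rshift k 0) (partial (rshift k 0) (susp F)) y = 0.
  transitivity (partial (rshift k 0)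
    (cst (row_mx 0 (delta_mx 0 0)) : _ -> 'rV[R]_(m + 1)) y).
    apply: near_eq_derive; apply: filterS nearU => z Uz.
    by rewrite partial_susp_rshift//; exact: dF.
  by rewrite partial_cst.
rewrite add0r !partial_susp_rshift; try exact: dF.
rewrite christoffel_form_warp_fiber ?row_mxKl ?row_mxKr//.
by rewrite /normal_part !mul0mx subr0 row_mx0.
Qed.

Lemma mean_curvature_susp :
  mean_curvature (warp s G) (susp F) y
  = row_mx ((s (rsubmx y 0 0))^-1 *: mean_curvature G F u) 0.
Proof.
rewrite /mean_curvature first_form_susp.
rewrite (trace_scaled_block s_neq0 unitI (S := fun a b =>
  row_mx (second_form G F u a b) 0)) => [|a b|].
(* The embedding of horizontal vectors is linear, so it commutes with the trace. *)
- rewrite -[RHS]susp_leftE [RHS]linearZ [in RHS]linear_sum.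
  apply: (congr1 ( *:%R _)); apply: eq_bigr => a _.
  rewrite [RHS]linear_sum; apply: eq_bigr => b _.
  by rewrite [RHS]linearZ -susp_leftE.
- exact: second_form_susp.
- exact: second_form_susp_fiber.
Qed.

End MeanCurvature.

(** * Invertibility of Gram matrices *)

Section PositiveDefinite.
Variables (R : realFieldType) (m : nat) (A : 'M[R]_m).
Hypothesis posA : forall v : 'rV[R]_m, v != 0 -> 0 < (v *m A *m v^T) 0 0.

(** If [v] is in the kernel, then [v *m D] has zero length, hence is 0, hence so is [v]. This covers
    first fundamental forms of immersions and, with [D = 1], the metric itself. *)
Lemma posdef_congr_unitmx k (D : 'M[R]_(k, m)) :
  row_free D -> D *m A *m D^T \in unitmx.
Proof.
move=> fD; rewrite -row_free_unit; apply: inj_row_free => v vI.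
suff : v *m D = 0 by move/eqP; rewrite mulmx_free_eq0// => /eqP.
apply/eqP/negPn/negP => /posA.
have -> : v *m D *m A *m (v *m D)^T = v *m (D *m A *m D^T) *m v^T.
  by rewrite trmx_mul !mulmxA.
by rewrite vI mul0mx mxE ltxx.
Qed.

Lemma posdef_unitmx : A \in unitmx.
Proof.
have := @posdef_congr_unitmx m 1%:M.
by rewrite mul1mx trmx1 mulmx1; apply; rewrite row_free_unit unitmx1.
Qed.

End PositiveDefinite.

(** * Comparison of a map on [M] with its lift to the cone *)

Section Cone.
Variables (R : realType) (m : nat) (M : manifold R m).
Variable (g : chart_id M -> M -> 'M[R]_m).

(** This is [t^2] for [t > 0] and 1 elsewhere. Going through [posreal_of] makes [cone_metric_warp]
    hold by conversion and keeps the scale nonzero everywhere. *)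
Definition cone_scale (t : R) : R := posval (posreal_of t) ^+ 2.

Lemma cone_scale_neq0 (t : R) : cone_scale t != 0.
Proof. by rewrite expf_neq0// gt_eqF// posval_gt0. Qed.

Lemma cone_metric_warp (c : chart_id (cone M)) :
  cone_metric g c \o pnt c = warp cone_scale (g c \o @pnt _ _ M c).
Proof. by []. Qed.

Lemma pnt_crd (c : chart_id M) (p : M) : dom c p -> pnt c (crd c p) = p.
Proof. exact: cmapK. Qed.

Lemma lsubmx_cone_map (c : chart_id M) (q : cone M) :
  lsubmx (cone_map c q) = crd c q.1.
Proof. exact: row_mxKl. Qed.

Lemma rsubmx_cone_map (c : chart_id M) (q : cone M) :
  rsubmx (cone_map c q) 0 0 = posval q.2.
Proof. by rewrite row_mxKr mxE eqxx. Qed.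

Hypothesis gM : riemannian_metric g.

Lemma metric_unitmx (c : chart_id M) (p : M) : dom c p -> g c p \in unitmx.
Proof. by case: gM => _ _ _ posg cp; apply: posdef_unitmx => v; exact: posg. Qed.

Lemma metric_differentiable (c : chart_id M) (p : M) : dom c p ->
  differentiable (g c \o pnt c) (crd c p).
Proof.
by case: gM => + _ _ _ cp => /(_ c 1%N)[dg _]; apply: dg; exists p.
Qed.

Section Map.
Variables (k : nat) (N : manifold R k) (f : M -> N).
Local Notation fC := (f \o @cone_proj R m M).

(** Charts of the cone are indexed by charts of [M], so the same [c] denotes a chart of either
    manifold. *)
Lemma local_expr_cone (c : chart_id (cone M)) (d : chart_id N) :
  local_expr fC c d = @local_expr _ _ _ M N f c d \o lsubmx.
Proof. by []. Qed.

Lemma laplacian_cone (c : chart_id (cone M)) (q : cone M)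
    (u : 'rV[R]_m -> R) :
  dom c q ->
  laplacian (cone_metric g c \o pnt c) (u \o lsubmx) (crd c q)
  = (posval q.2 ^+ 2)^-1 * laplacian (g c \o @pnt _ _ M c) u (@crd _ _ M c q.1).
Proof.
move=> cq; have ly := lsubmx_cone_map c q; have ry := rsubmx_cone_map c q.
rewrite cone_metric_warp laplacian_warp; rewrite /crd /= ?ly ?ry.
- by rewrite /cone_scale posvalK.
- exact: cone_scale_neq0.
- by rewrite -/(@pnt _ _ M c _) pnt_crd//; exact: metric_unitmx.
- exact: metric_differentiable.
Qed.

Lemma tension_cone (c : chart_id (cone M)) (q : cone M) (d : chart_id N)
    (H : 'rV[R]_k -> 'M[R]_k) :
  dom c q ->
  tension (cone_metric g c \o pnt c) H (local_expr fC c d) (crd c q)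
  = (posval q.2 ^+ 2)^-1 *:
    tension (g c \o @pnt _ _ M c) H (@local_expr _ _ _ M N f c d)
      (@crd _ _ M c q.1).
Proof.
move=> cq; have ly := lsubmx_cone_map c q; have ry := rsubmx_cone_map c q.
rewrite cone_metric_warp local_expr_cone tension_warp; rewrite /crd /= ?ly ?ry.
- by rewrite /cone_scale posvalK.
- exact: cone_scale_neq0.
- by rewrite -/(@pnt _ _ M c _) pnt_crd//; exact: metric_unitmx.
- exact: metric_differentiable.
Qed.

Hypothesis smooth_f : smooth_map f.

Lemma dmx_cone (c : chart_id (cone M)) (d : chart_id N) (q : cone M) :
  dom c q -> dom d (fC q) ->
  dmx fC c d q = col_mx (@dmx _ _ _ M N f c d q.1) 0.
Proof.
move=> cq dq; rewrite /dmx local_expr_cone jacobian_lsubmx.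
  by rewrite lsubmx_cone_map.
rewrite lsubmx_cone_map; have [_ /(_ c d 1%N)[df _]] := smooth_f.
by apply: df; exists q.1.
Qed.

(** The factor comes from the horizontal block of the inverse metric; the fibre block meets the zero
    row of the differential. *)
Lemma adjoint_mx_cone (c : chart_id (cone M)) (d : chart_id N) (q : cone M)
    (H : 'M[R]_k) :
  dom c q -> dom d (fC q) ->
  let D := dmx fC c d q in let D0 := @dmx _ _ _ M N f c d q.1 in
  adjoint_mx (cone_metric g c q) H D *m D
  = (posval q.2 ^+ 2)^-1 *: (adjoint_mx (g c q.1) H D0 *m D0).
Proof.
move=> cq dq /=; rewrite dmx_cone// /adjoint_mx /cone_metric.
rewrite invmx_scaled_block; last 2 first.
- by rewrite expf_neq0// gt_eqF// posval_gt0.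
- exact: metric_unitmx.
rewrite tr_col_mx trmx0 mul_mx_row mulmx0 mul_row_block mul_row_col.
by rewrite !(mulmx0, mul0mx, addr0) -scalemxAr -scalemxAl.
Qed.

(** The differential of the lift only gains a zero row, which leaves the row space unchanged. *)
Lemma submersive_cone : submersive f <-> submersive fC.
Proof.
have fullE (c : chart_id M) d q : @dom _ _ M c q.1 -> dom d (f q.1) ->
    row_full (@dmx _ _ _ (cone M) N fC c d q) = row_full (dmx f c d q.1).
  by move=> cq dq; rewrite dmx_cone// /row_full -addsmxE addsmx0.
split=> sf => [q c d cq dq|p c d cp dp].
  by rewrite fullE//; exact: sf.
(* Descent to [M] needs just one point of the cone over [p]; height 1 is chosen, here and below. *)
by rewrite -(fullE c d (p, posreal_of 1))//; exact: sf.
Qed.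

Lemma harmonic_map_cone (h : chart_id N -> N -> 'M[R]_k) :
  harmonic_map g h f <-> harmonic_map (cone_metric g) h fC.
Proof.
split=> hf => [q c d cq dq|p c d cp dp].
  by rewrite tension_cone// hf// scaler0.
have := hf (p, posreal_of 1) c d cp dp.
rewrite tension_cone// => /eqP; rewrite scaler_eq0 invr_eq0 expf_eq0/=.
by rewrite gt_eqF ?posval_gt0//= => /eqP.
Qed.

Lemma PHWC_cone (J h : chart_id N -> N -> 'M[R]_k) :
  PHWC g J h f <-> PHWC (cone_metric g) J h fC.
Proof.
split=> Hf => [q c d cq dq|p c d cp dp] /=.
  by rewrite adjoint_mx_cone// -scalemxAl -scalemxAr; congr (_ *: _); exact: Hf.
have := Hf (p, posreal_of 1) c d cp dp.
rewrite /= adjoint_mx_cone// -scalemxAl -scalemxAr.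
apply: scalerI; rewrite invr_eq0 expf_neq0// gt_eqF// posval_gt0//.
Qed.

(** The same holomorphic [w] tests both maps, and the Laplacian of its pullback to the cone is
    [t^-2] times the one on [M]. *)
Lemma pseudo_harmonic_morphism_cone (J : chart_id N -> N -> 'M[R]_k) :
  pseudo_harmonic_morphism g J f
  <-> pseudo_harmonic_morphism (cone_metric g) J fC.
Proof.
split=> Hf V w oV hw => [q c Vq cq|p c Vp cp].
  have [lr li] := Hf V w oV hw q.1 c Vq cq.
  split; first by rewrite -[LHS]/(laplacian _
     ((@complex.Re R \o (w \o f) \o @pnt _ _ M c) \o lsubmx) _)
     laplacian_cone// lr mulr0.
  by rewrite -[LHS]/(laplacian _
     ((@complex.Im R \o (w \o f) \o @pnt _ _ M c) \o lsubmx) _)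
     laplacian_cone// li mulr0.
pose q : cone M := (p, posreal_of 1).
have q0 : (posval q.2 ^+ 2)^-1 != 0.
  by rewrite invr_eq0 expf_neq0// gt_eqF// posval_gt0.
have [lr li] := Hf V w oV hw q c Vp cp; split.
  apply: (mulfI q0); rewrite mulr0 -[RHS]lr; apply/esym.
  exact: (@laplacian_cone c q (@complex.Re R \o (w \o f) \o @pnt _ _ M c)).
apply: (mulfI q0); rewrite mulr0 -[RHS]li; apply/esym.
exact: (@laplacian_cone c q (@complex.Im R \o (w \o f) \o @pnt _ _ M c)).
Qed.

End Map.
End Cone.

(** * Cones over submanifolds and their minimality *)

Lemma row_mx_scalar_continuous (R : realType) k :
  continuous (fun z : 'rV[R]_k * R => row_mx z.1 z.2%:M : 'rV[R]_(k + 1)).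
Proof.
move=> z; apply: continuous_mx => i j; rewrite ord1.
case: (splitP j) => l jl.
  have -> : j = lshift 1 l by exact: val_inj.
  rewrite (_ : (fun _ => _) = (fun v : 'rV[R]_k => v 0 l) \o (@fst 'rV[R]_k R)).
    apply: continuous_comp; [exact: cvg_fst | exact: coord_continuous].
  by apply/funext => w; rewrite row_mxEl.
have -> : j = rshift k l by exact: val_inj.
rewrite (_ : (fun _ => _) = @snd 'rV[R]_k R); first exact: cvg_snd.
by apply/funext => w; rewrite row_mxEr mxE ord1 eqxx.
Qed.

Section ConeParametrization.
Variables (R : realType) (m : nat) (M : manifold R m).
Variables (S : set M) (p : M) (k : nat) (U : set 'rV[R]_k) (X : 'rV[R]_k -> M).

Definition cone_par (y : 'rV[R]_(k + 1)) : cone M :=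
  (X (lsubmx y), posreal_of (rsubmx y 0 0)).

(** The condition [t > 0] removes the region where [posreal_of] is constant and [cone_par] is not
    injective. *)
Definition cone_par_dom : set 'rV[R]_(k + 1) :=
  lsubmx @^-1` U `&` (fun y => rsubmx y 0 0) @^-1` [set t | 0 < t].

Hypothesis pX : local_parametrization S p U X.

Lemma open_lp_chart (c : chart_id M) : open (U `&` X @^-1` dom c).
Proof.
rewrite openE => u [Uu cu]; apply: filterI.
  by apply: open_nbhs_nbhs; split=> //; exact: lp_open pX.
apply: (lp_continuous pX Uu).
by apply: open_nbhs_nbhs; split=> //; exact: cdom_open.
Qed.

Lemma lp_chart_Ck (c : chart_id M) j : Ck j (U `&` X @^-1` dom c) (crd c \o X).
Proof. exact: (lp_smooth pX). Qed.

Lemma lp_chart_differentiable (c : chart_id M) u :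
  U u -> dom c (X u) -> differentiable (crd c \o X) u.
Proof. by move=> Uu cu; have [dX _] := lp_chart_Ck c 1; exact: dX. Qed.

Lemma open_cone_par_dom : open cone_par_dom.
Proof.
apply: openI; apply: open_comp.
- by move=> y _; exact: continuous_lsubmx.
- exact: lp_open pX.
- by move=> y _; exact: rsubmx00_continuous.
- exact: open_gt.
Qed.

Lemma crd_cone_par (c : chart_id (cone M)) y :
  cone_par_dom y -> crd c (cone_par y) = susp (@crd _ _ M c \o X) y.
Proof.
move=> [_ /= y0]; rewrite /crd /= /cone_map /susp /= posreal_ofK//.
by rewrite -mx11_scalar.
Qed.

Lemma near_crd_cone_par (c : chart_id (cone M)) y :
  cone_par_dom y -> {near y, susp (@crd _ _ M c \o X) =1 crd c \o cone_par}.
Proof.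
move=> Uy; have : nbhs y cone_par_dom.
  by apply: open_nbhs_nbhs; split=> //; exact: open_cone_par_dom.
by apply: filterS => z Uz; rewrite /= crd_cone_par.
Qed.

Lemma local_parametrization_cone (t : posreal R) :
  local_parametrization (@cone_proj _ _ M @^-1` S) (p, t) cone_par_dom cone_par.
Proof.
split.
- exact: open_cone_par_dom.
- have [u Uu up] := lp_point pX; exists (row_mx u (posval t)%:M).
    by split; rewrite /= ?row_mxKl ?row_mxKr// mxE eqxx posval_gt0.
  by rewrite /cone_par row_mxKl row_mxKr mxE eqxx mulr1n posvalK up.
- have [W oW XU] := lp_image pX; exists (fst @^-1` W).
    by apply: open_comp => // q _; exact: cvg_fst.
  apply/seteqP; split=> [_ [y [Uy y0] <-]|[q r] [/= Sq Wq]].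
    by have [] : (S `&` W) (X (lsubmx y)) by rewrite -XU; exists (lsubmx y).
  have [u Uu uq] : (X @` U) q by rewrite XU.
  exists (row_mx u (posval r)%:M).
    by split; rewrite /= ?row_mxKl ?row_mxKr// mxE eqxx posval_gt0.
  by rewrite /cone_par row_mxKl row_mxKr mxE eqxx mulr1n posvalK uq.
- move=> y [Uy y0].
  have c1 : {for y, continuous (X \o (lsubmx : 'rV[R]_(k + 1) -> 'rV[R]_k))}.
    apply: continuous_comp; first exact: continuous_lsubmx.
    exact: (lp_continuous pX Uy).
  have c2 : {for y, continuous
      (@posreal_of R \o (fun v : 'rV[R]_(k + 1) => rsubmx v 0 0))}.
    apply: continuous_comp; first exact: rsubmx00_continuous.
    exact: posreal_of_continuous.
  exact: (cvg_pair c1 c2).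
- have [Y cY YX] := lp_inverse pX.
  (* The inverse is the product of [Y] with the height. *)
  exists (fun q => row_mx (Y q.1) (posval q.2)%:M); last first.
    move=> y [Uy y0]; rewrite /cone_par /= YX// posreal_ofK//.
    by rewrite -mx11_scalar hsubmxK.
  apply/subspace_continuousP => q [y [Uy y0] yq].
  have Xq : (X @` U) q.1 by exists (lsubmx y) => //; rewrite -yq.
  (* Points in the image of [cone_par] project into the image of [X], so a relative neighbourhood of
     [q.1] pulls back to one of [q]. *)
  have c1 : Y z.1 @[z --> within (cone_par @` cone_par_dom) (nbhs q)] --> Y q.1.
    move/subspace_continuousP: cY => /(_ _ Xq) cY B /cY.
    rewrite /= /within /= => nB.
    have : nbhs q (fst @^-1` [set x | (X @` U) x -> (Y @^-1` B) x]).
      exact: cvg_fst.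
    apply: filterS => z /= zB [y' [Uy' _] yz]; apply: zB.
    by exists (lsubmx y') => //; rewrite -yz.
  have c2 : posval z.2 @[z --> within (cone_par @` cone_par_dom) (nbhs q)]
      --> posval q.2.
    apply: cvg_within_filter.
    apply: (@continuous_comp _ _ _ (@snd M (posreal R)) (@posval R)).
      exact: cvg_snd.
    exact: posval_continuous.
  move=> B nB.
  have nB' : nbhs (Y q.1, posval q.2)
      ((fun w : 'rV[R]_k * R => row_mx w.1 w.2%:M : 'rV[R]_(k + 1)) @^-1` B).
    exact: (@row_mx_scalar_continuous R k (Y q.1, posval q.2)).
  exact: (cvg_pair c1 c2 nB').
- move=> c j; pose W := U `&` X @^-1` @dom _ _ M c.
  have oW : open W by exact: open_lp_chart.
  have sub : cone_par_dom `&` cone_par @^-1` dom c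
      `<=` (lsubmx : 'rV[R]_(k + 1) -> 'rV[R]_k) @^-1` W.
    by move=> y [[Uy _] cy].
  have oD : open (cone_par_dom `&` cone_par @^-1` dom c).
    rewrite (_ : _ `&` _ = cone_par_dom `&` lsubmx @^-1` W).
      apply: openI; first exact: open_cone_par_dom.
      by apply: open_comp => // y _; exact: continuous_lsubmx.
    by apply/seteqP; split=> y [Uy cy]; split=> //; [exact: sub | case: cy].
  apply: (Ck_eq oD _ (Ck_sub sub (Ck_susp oW (@lp_chart_Ck c j)))) => y [Uy _].
  by rewrite -crd_cone_par.
- move=> y c Uy cy; have dX : differentiable (@crd _ _ M c \o X) (lsubmx y).
    by apply: lp_chart_differentiable => //; case: Uy.
  (* The Jacobian is block diagonal with blocks that of [X] and 1, so a kernel vector has zero last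
     entry and its remaining part is killed by an injective matrix. *)
  rewrite -(jacobian_near_eq (near_crd_cone_par c Uy) (differentiable_susp dX)).
  rewrite jacobian_susp//; apply: inj_row_free => v.
  rewrite -[v]hsubmxK mul_row_block !mulmx0 addr0 add0r mulmx1.
  rewrite -[X in _ = X](@row_mx0 _ 1 m 1) => /eq_row_mx[+ ->].
  move/eqP; rewrite mulmx_free_eq0; first by move/eqP ->; rewrite row_mx0.
  by apply: lp_immersion pX _ _ _ _ => //; case: Uy.
Qed.

End ConeParametrization.

Lemma minimal_submanifold_cone (R : realType) m (M : manifold R m)
    (g : chart_id M -> M -> 'M[R]_m) (S : set M) :
  riemannian_metric g -> minimal_submanifold g S ->
  minimal_submanifold (cone_metric g) (@cone_proj _ _ M @^-1` S).
Proof.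
move=> gM [k minS]; exists (k + 1)%N => -[p t] Sp.
have [U [X [pX HX]]] := minS p Sp.
exists (cone_par_dom U), (cone_par X).
split=> [|y c Uy cy]; first exact: local_parametrization_cone.
have [Uu _] := Uy.
have dX : differentiable (@crd _ _ M c \o X) (lsubmx y).
  exact: (lp_chart_differentiable pX).
(* In the chart the parametrization is a suspension near [y], whose mean curvature is a multiple of
   that of [X]. *)
rewrite -(mean_curvature_near_eq _ (near_crd_cone_par pX c Uy)
  (differentiable_susp dX)).
rewrite cone_metric_warp (mean_curvature_susp (U := U `&` X @^-1` @dom _ _ M c)
  (open_lp_chart (c := c) pX) (lp_chart_Ck pX c 2)).
- by rewrite HX// scaler0 row_mx0.
- by split.
- exact: cone_scale_neq0.
- by rewrite /= pnt_crd//; exact: metric_unitmx.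
- exact: metric_differentiable.
- rewrite /first_form /= pnt_crd//; apply: posdef_congr_unitmx.
    by case: gM => _ _ _ posg v; exact: posg.
  exact: lp_immersion pX _ _ _ _.
Qed.

(** * Holomorphy and the Reeb field *)

Section AlmostContact.
Variables (R : realType) (m : nat) (M : manifold R m).
Variables (phi : chart_id M -> M -> 'M[R]_m) (xi : chart_id M -> M -> 'rV[R]_m).
Variables (eta : chart_id M -> M -> 'cV[R]_m) (g : chart_id M -> M -> 'M[R]_m).
Hypothesis acmM : almost_contact_metric phi xi eta g.

(* Since [xi phi^2 = 0], also [(xi phi) phi^2 = 0], so [xi phi] is a multiple
   [a xi]; then [a^2 xi = xi phi^2 = 0]. *)
Lemma reeb_phi (c : chart_id M) (p : M) : dom c p -> xi c p *m phi c p = 0.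
Proof.
move=> cp; have ph2 := acm_phi2 acmM cp; have ex := acm_eta_xi acmM cp.
have xph2 : xi c p *m phi c p *m phi c p = 0.
  by rewrite -mulmxA ph2 mulmxDr mulmxN mulmx1 mulmxA ex mul1mx addNr.
have [a xpE] : exists a : 'M_1, xi c p *m phi c p = a *m xi c p.
  exists (xi c p *m phi c p *m eta c p).
  apply/eqP; rewrite eq_sym -subr_eq0 addrC -[X in - X]mulmx1 -mulmxN.
  by rewrite -[_ *m eta c p *m _]mulmxA -mulmxDr -ph2 mulmxA xph2 mul0mx.
have aax : a *m (a *m xi c p) = 0 by rewrite -xpE mulmxA -xpE.
have /eqP : a 0 0 ^+ 2 = 0.
  have -> : a 0 0 ^+ 2 = (a *m (a *m xi c p) *m eta c p) 0 0.
    by rewrite -!mulmxA ex mulmx1 mxE big_ord1.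
  by rewrite aax mul0mx mxE.
rewrite sqrf_eq0 => /eqP a0; rewrite xpE [a]mx11_scalar a0 mul_scalar_mx.
exact: scale0r.
Qed.

(** In block form, holomorphy of the lift is the intertwining with [phi] together with the vanishing
    of [df(xi)]. *)
Lemma intertwines_cone k (N : manifold R k) (J h : chart_id N -> N -> 'M[R]_k)
    (f : M -> N) : almost_hermitian J h -> smooth_map f ->
  intertwines phi J f
  <-> intertwines (cone_J phi xi eta) J (f \o @cone_proj _ _ M).
Proof.
move=> ahN sf; have JD q c d : @dom _ _ M c q.1 -> dom d (f q.1) ->
    cone_J phi xi eta c q *m @dmx _ _ _ (cone M) N (f \o @cone_proj _ _ M) c d q
      = col_mx (phi c q.1 *m dmx f c d q.1) (- (xi c q.1 *m dmx f c d q.1)).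
  by move=> cq dq; rewrite dmx_cone// mul_block_col !mulmx0 !addr0 mulNmx.
split=> hf => [q c d cq dq|p c d cp dp].
  rewrite JD// dmx_cone// mul_col_mx mul0mx; have e := hf q.1 c d cq dq.
  suff xD : xi c q.1 *m dmx f c d q.1 = 0 by rewrite xD oppr0 e.
  have xDJ : xi c q.1 *m dmx f c d q.1 *m J d (f q.1) = 0.
    by rewrite -mulmxA -e mulmxA reeb_phi// mul0mx.
  (* A vector killed by [J] is 0, because [J^2 = -1]. *)
  apply: oppr_inj; rewrite oppr0 -[X in - X]mulmx1 -mulmxN -(ah_J2 ahN dq).
  by rewrite mulmxA xDJ mul0mx.
have := hf (p, posreal_of 1) c d cp dp.
by rewrite JD// dmx_cone// mul_col_mx => /eq_col_mx[].
Qed.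

End AlmostContact.

Theorem proposition5p1 (R : realType) (n : nat) (n_ge2 : (2 <= n)%N)
    (M : manifold R (n + n).+1)
    (phi : chart_id M -> M -> 'M[R]_((n + n).+1))
    (xi : chart_id M -> M -> 'rV[R]_((n + n).+1))
    (eta : chart_id M -> M -> 'cV[R]_((n + n).+1))
    (g : chart_id M -> M -> 'M[R]_((n + n).+1))
    (acmM : almost_contact_metric phi xi eta g)
    (N : manifold R (n + n)) (JN h : chart_id N -> N -> 'M[R]_(n + n))
    (ahN : almost_hermitian JN h)
    (f : M -> N) (smooth_f : smooth_map f) :
  let J := cone_J phi xi eta in
  let gC := cone_metric g in
  let fC := f \o @cone_proj R _ M in
  [/\ intertwines phi JN f <-> intertwines J JN fC,
      (PHWC g JN h f /\ harmonic_map g h f <->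
         PHWC gC JN h fC /\ harmonic_map gC h fC) /\
      (kahler JN h ->
         (strong_pseudo_harmonic_morphism g JN h f <->
          strong_pseudo_harmonic_morphism gC JN h fC)),
      (submersive f <-> submersive fC) /\
      (submersive f -> forall P : set N, complex_submanifold JN P ->
         minimal_submanifold g (f @^-1` P) ->
         minimal_submanifold gC (fC @^-1` P))
    & pseudo_harmonic_morphism g JN f <-> pseudo_harmonic_morphism gC JN fC].
Proof.
have gM := acm_g acmM.
move=> J gC fC; split.
- exact: (intertwines_cone acmM ahN smooth_f).
- split=> [|kN].
    by rewrite (PHWC_cone gM smooth_f) (harmonic_map_cone gM).
  (* The Kähler condition concerns the target, common to both maps, so the equivalence for
     pseudo-harmonic morphisms suffices. *)
  by rewrite /strong_pseudo_harmonic_morphism (pseudo_harmonic_morphism_cone gM).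
- split=> [|_ P _]; first exact: submersive_cone.
  (* The preimage of [P] under the lift is by definition the cone over its preimage under [f]. *)
  exact: (minimal_submanifold_cone gM).
- exact: pseudo_harmonic_morphism_cone.
Qed.
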